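(* Let $Y$ be a non-compact metrizable space, and let $X$ be a $Y$-Tychonoff space. Fix a closed and discrete sequence $\mathcal D=\{g_n\}_{n\in\omega}$ in $Y$, and let $H$ be a relatively $\mathcal D_p$-Tychonoff subspace of $C_p(X,Y)$ containing the constant function $\mathbf g_0$ (with value $g_0$). Then the following assertions are equivalent: (i) $H$ is a Fréchet–Urysohn space; (ii) $H$ is a sequential space; (iii) $H$ is a $k$-space; (iv) $X$ satisfies the property $\gamma$.
   Context: $C_p(X,Y)$ is the space of all continuous functions $X\to Y$ with the topology of pointwise convergence. $X$ is $Y$-Tychonoff if for every closed $A\subseteq X$, point $y_0\in Y$ and function $f:F\to Y$ on a finite set $F\subseteq X\setminus A$ there is a continuous $\bar f:X\to Y$ with $\bar f|_F=f$ and $\bar f(A)\subseteq\{y_0\}$. A closed and discrete sequence $\{g_n\}_{n\in\omega}$ is a sequence of pairwise distinct points whose set of terms is closed and discrete in $Y$. For $\mathcal D\subseteq Y$, a subspace $H$ of $S=C_p(X,Y)$ is relatively $\mathcal D_p$-Tychonoff in $S$ if for every closed $A\subseteq X$, every finite $F\subseteq X\setminus A$, every $y_0\in\mathcal D$ and each $f\in S$ with $f(F)\subseteq\mathcal D$ there is $\bar f\in H$ with $\bar f|_F=f|_F$ and $\bar f(A)\subseteq\{y_0\}$. A family $\gamma$ of subsets of $X$ is an $\omega$-cover if every finite subset of $X$ is contained in some member of $\gamma$. $X$ has the property $\gamma$ if for every open $\omega$-cover there is a sequence $\{U_n\}_{n\in\omega}$ of its members with $\bigcup_{n}\bigcap_{i\ge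 n}U_i=X$. A space is Fréchet–Urysohn if whenever $a\in\overline A$ there is a sequence in $A$ converging to $a$; sequential if for each non-closed $A$ there is a sequence in $A$ converging to a point of $\overline A\setminus A$; a $k$-space if for each non-closed $A$ there is a compact $K$ such that $A\cap K$ is not closed in $K$. *)

(* Defs.v *)
From HB Require Import structures.
From mathcomp Require Import all_boot all_order all_algebra.
From mathcomp Require Import all_classical all_reals all_analysis.

Set Implicit Arguments.
Unset Strict Implicit.
Unset Printing Implicit Defensive.

Import Order.TTheory GRing.Theory Num.Theory.

Local Open Scope classical_set_scope.
Local Open Scope ring_scope.

Definition Cp (X Y : topologicalType) : Type := continuousType X Y.

(* The topology inherited from the product topology on X -> Y. *)
HB.instance Definition _ (X Y : topologicalType) :=
  Topological.copy (Cp X Y)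
    (initial_topology (id : continuousType X Y -> {ptws X -> Y})).

Definition metrizable (R : realType) (Y : topologicalType) : Prop :=
  exists d : Y -> Y -> R,
    [/\ forall x y, d x y = 0 <-> x = y,
        forall x y, d x y = d y x,
        forall x y z, d x z <= d x y + d y z &
        forall x, nbhs x = nbhs_ball_ (fun y e => [set z | d y z < e]) x].

(* The function F -> Y is given by the restriction to F of some f : X -> Y.
   No function is lost: Y is inhabited by y0. *)
Definition tychonoff_wrt (X Y : topologicalType) : Prop :=
  forall (A : set X) (y0 : Y) (F : set X) (f : X -> Y),
    closed A -> finite_set F -> F `<=` ~` A ->
    exists fbar : X -> Y,
      [/\ continuous fbar,
          forall x, F x -> fbar x = f x &
          fbar @` A `<=` [set y0]].

Definition closed_discrete_sequence (Y : topologicalType) (g : nat -> Y) : Prop :=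
  [/\ injective g, closed (range g) & isolated (range g) = range g].

Definition relatively_tychonoff (X Y : topologicalType) (D : set Y)
    (H : set (Cp X Y)) : Prop :=
  forall (A F : set X) (y0 : Y) (f : Cp X Y),
    closed A -> finite_set F -> F `<=` ~` A -> D y0 -> f @` F `<=` D ->
    exists fbar : Cp X Y,
      [/\ H fbar,
          forall x, F x -> fbar x = f x &
          fbar @` A `<=` [set y0]].

Definition omega_cover (X : Type) (C : set (set X)) : Prop :=
  forall F : set X, finite_set F -> exists2 U, C U & F `<=` U.

Definition property_gamma (X : topologicalType) : Prop :=
  forall C : set (set X), C `<=` open -> omega_cover C ->
    exists U : nat -> set X,
      (forall n, C (U n)) /\
      \bigcup_n \bigcap_(i in [set i | (n <= i)%N]) U i = [set: X].

Definition frechet_urysohn (T : topologicalType) : Prop :=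
  forall (A : set T) (a : T), closure A a ->
    exists u : nat -> T, (forall n, A (u n)) /\ u @ \oo --> a.

Definition sequential (T : topologicalType) : Prop :=
  forall A : set T, ~ closed A ->
    exists (u : nat -> T) (a : T),
      [/\ forall n, A (u n), (closure A `\` A) a & u @ \oo --> a].

(* The trace of A on K is taken as a subset of K with its subspace topology. *)
Definition k_space (T : topologicalType) : Prop :=
  forall A : set T, ~ closed A ->
    exists2 K : set T, compact K &
      ~ closed ((set_val : set_type K -> T) @^-1` A).

(* Main.v *)
Require Import Defs.
From mathcomp Require Import all_boot all_order all_algebra finmap.
From mathcomp Require Import all_classical all_reals all_analysis.
From mathcomp Require Import lra.

(** The implications from Fréchet-Urysohn to sequential and from sequential to
    k-space hold in every topological space.

    That the property gamma of [X] makes [H] Fréchet-Urysohn is the argument of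
    Gerlits and Nagy [gamma_frechet_urysohn]: the sets on which the members of
    a set [A] are close to an adherent point [a] form open omega-covers, and a
    sequence of them converging to [X] comes from functions converging to [a].

    The substance is that [X] has the property gamma when [H] is a k-space.
    Functions equal to [g 0] on a finite set and to [g n] off a member of a
    cover adhere to the constant [g 0], and a compact set of functions takes at
    each point finitely many of the values [g n]. This gives a selection
    principle [k_space_selective]: if open families [C n] together omega-cover
    [X], there are sets converging to [X], each omega-covered by a single
    [C n]. Applied to singletons [C n], it turns a countable omega-cover into a
    sequence as in the property gamma, so there remains to extract countable
    omega-subcovers [k_space_countable_subcover].

    If an omega-cover [C] has no countable omega-subcover, let [S] be the set
    of the [h] such that a countable part of [C] omega-covers the points where
    [h] differs from [g 1]. The constant [g 0] adheres to [S] without belonging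
    to it, so there are a compact set [K] and a point [f] of [K] outside [S]
    that adheres to [S `&` K]. No countable part of [S] has [f] in its closure,
    so that one can build, like free sequences in compact spaces of uncountable
    tightness, long families of pairs of a function of [S `&` K] and a finite
    set of points: each function agrees with [f] on the earlier finite sets and
    takes the value [g 1] somewhere on each later one. Compactness of [K] makes
    the family of finite sets thin (every finite [F] has an open neighbourhood
    containing finitely many of them) and Zorn's lemma for end extension
    replaces transfinite recursion to make it uncountable
    [exists_uncountable_thin]. But the selection principle, for the families of
    open sets containing at most [n] of the finite sets, shows that thin
    families are countable [selective_thin_countable]. *)

Set Implicit Arguments.
Unset Strict Implicit.
Unset Printing Implicit Defensive.

Import Order.TTheory GRing.Theory Num.Theory.

Local Open Scope classical_set_scope.

(** * Metrics *)

(** The condition that [metrizable] puts on a distance, for a fixed [d]. *)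
Definition metrizes (R : realType) (Y : topologicalType) (d : Y -> Y -> R) :=
  [/\ forall x y, d x y = 0%R <-> x = y,
      forall x y, d x y = d y x,
      forall x y z, (d x z <= d x y + d y z)%R &
      forall x, nbhs x = nbhs_ball_ (fun y e => [set z | (d y z < e)%R]) x].

Section Metric.
Variables (R : realType) (Y : topologicalType) (d : Y -> Y -> R).
Hypothesis dY : metrizes d.
Local Open Scope ring_scope.

Lemma dist_eq0 x y : d x y = 0 <-> x = y. Proof. by case: dY. Qed.

Lemma dist_sym x y : d x y = d y x. Proof. by case: dY. Qed.

Lemma dist_triangle x y z : d x z <= d x y + d y z. Proof. by case: dY. Qed.

Lemma dist_ge0 x y : 0 <= d x y.
Proof.
have := dist_triangle x y x; rewrite (dist_sym y x).
by have /dist_eq0 -> : x = x by []; lra.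
Qed.

Lemma dist_gt0 x y : x <> y -> 0 < d x y.
Proof.
by move=> xy; rewrite lt_def dist_ge0 andbT; apply/eqP => /dist_eq0.
Qed.

Lemma nbhs_dist y (A : set Y) :
  nbhs y A <-> exists2 e, 0 < e & forall z, d y z < e -> A z.
Proof. by case: dY => _ _ _ ->; split => -[e e0 eA]; exists e. Qed.

Lemma nbhs_ball_dist y e : 0 < e -> nbhs y [set z | d y z < e].
Proof. by move=> e0; apply/nbhs_dist; exists e. Qed.

Lemma metrizes_hausdorff : hausdorff_space Y.
Proof.
move=> p q pq; apply: contrapT => /dist_gt0 pq0.
have e0 : 0 < d p q / 2 by lra.
have [z /= [pz qz]] := pq _ _ (nbhs_ball_dist p e0) (nbhs_ball_dist q e0).
by have := dist_triangle p z q; rewrite (dist_sym z q); lra.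
Qed.

Lemma open_dist_ball y e : open [set z | d y z < e].
Proof.
rewrite openE => z /= yz; apply/nbhs_dist; exists (e - d y z); first by lra.
by move=> w zw /=; have := dist_triangle y z w; lra.
Qed.

End Metric.

(** * General topology *)

Lemma hausdorff_closed1 (Y : topologicalType) (y : Y) :
  hausdorff_space Y -> closed [set y].
Proof. by move=> /hausdorff_accessible /accessible_closed_set1. Qed.

Lemma cluster_closed (T : topologicalType) (G : set_system T) (E : set T) a :
  closed E -> G E -> cluster G a -> E a.
Proof. by move=> cE GE Ga; apply: cE => N aN; exact: Ga. Qed.

Lemma filter_forall_finite (T : Type) (X : choiceType) (G : set_system T)
    (F : set X) (Q : X -> set T) : Filter G -> finite_set F ->
  (forall x, F x -> G (Q x)) -> G [set t | forall x, F x -> Q x t].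
Proof. by move=> FG /finite_fsetP[s ->]; exact: filter_bigI. Qed.

(** As [K] has the subspace topology, a point of [K] adheres to the trace of
    [A] in [K] as soon as it does in [T]. *)
Lemma k_space_compact_witness (T : topologicalType) (A : set T) :
  k_space T -> ~ closed A ->
  exists (K : set T) (a : T), [/\ compact K, K a, ~ A a & closure (A `&` K) a].
Proof.
move=> kT /kT [K cK]; apply: contra_notP => noa p clp.
apply: contrapT => nAp; apply: noa; exists K, (set_val p); split => //.
  exact: set_valP.
move=> N pN.
have [q [Aq Nq]] : (set_val : set_type K -> T) @^-1` A
    `&` (set_val @^-1` N) !=set0.
  by apply: clp; exact: (@initial_continuous (set_type K) T set_val p).
by exists (set_val q); split=> //; split => //; exact: set_valP.
Qed.

(** An infinity of terms in [L] would have a cluster point in [L]; it would be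
    a term of the sequence, and isolation leaves room for one index only. *)
Lemma compact_closed_discrete_sequence (Y : topologicalType) (g : nat -> Y)
    (L : set Y) :
  closed_discrete_sequence g -> compact L ->
  exists N, forall n, (N <= n)%N -> ~ L (g n).
Proof.
move=> [ginj gcl giso] cL; apply: contrapT => noN.
have {noN} /choice[s sP] : forall N, exists n, (N <= n)%N /\ L (g n).
  move=> N; apply: contrapT => nn; apply: noN; exists N => n Nn Ln.
  by apply: nn; exists n.
have [y [Ly cy]] : L `&` cluster (g \o s @ \oo) !=set0.
  by apply: cL; exists 0%N => // n _ /=; case: (sP n).
have yg : range g y.
  apply: gcl => N yN.
  have : (g \o s @ \oo) (range g) by exists 0%N => // n _; exists (s n).
  by move=> /cy /(_ yN).
have : isolated (range g) y by rewrite giso.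
move=> [_ [V yV Vg]].
have sub n : V (g (s n)) -> g (s n) = y.
  by move=> Vn; have : (V `&` range g) (g (s n)) by []; rewrite Vg.
have gs_tail m : (g \o s @ \oo) [set g (s n) | n in [set n | (m <= n)%N]].
  by exists m => // n /= mn; exists n.
have [_ [[n _ <-] /sub yn]] := cy _ _ (gs_tail 0%N) yV.
have [_ [[n' nn' <-] /sub yn']] := cy _ _ (gs_tail (s n).+1) yV.
have /ginj ss : g (s n) = g (s n') by rewrite yn yn'.
by have := leq_trans nn' (sP n').1; rewrite -ss ltnn.
Qed.

Lemma frechet_urysohn_sequential (T : topologicalType) :
  frechet_urysohn T -> sequential T.
Proof.
move=> fT A nclA; have [a [cla nAa]] : exists a, closure A a /\ ~ A a.
  apply: contrapT => noa; apply: nclA => a cla; apply: contrapT => nAa.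
  by apply: noa; exists a.
by have [u [Au ua]] := fT A a cla; exists u, a.
Qed.

Lemma compact_cvg_sequence (T : topologicalType) (u : nat -> T) a :
  u @ \oo --> a -> compact (a |` range u).
Proof.
move=> ua G PG GK; apply: contrapT => noclus.
have [B [N [GB aN BN]]] : exists B N, [/\ G B, nbhs a N & ~ ((B `&` N) !=set0)].
  apply: contrapT => noBN; apply: noclus; exists a; split; first by left.
  by move=> B N GB aN; apply: contrapT => BN; apply: noBN; exists B, N.
have [m _ mN] := ua _ aN.
have cum : compact (u @` `I_m) by exact/finite_compact/finite_image/finite_II.
have [|_ [[n _ <-] Gn]] := cum G PG.
  apply: filterS (filterI GB GK) => x [Bx [xa|[n _ un]]].
    by case: BN; exists x; split=> //; rewrite xa; exact: nbhs_singleton.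
  exists n => //=; rewrite ltnNge; apply/negP => /mN /= Nn.
  by case: BN; exists x; split=> //; rewrite -un.
by apply: noclus; exists (u n); split=> //; right; exists n.
Qed.

Lemma sequential_k_space (T : topologicalType) : sequential T -> k_space T.
Proof.
move=> sT A /sT[u [a [Au [_ nAa] ua]]].
exists (a |` range u); first exact: compact_cvg_sequence.
set K := _ `|` _ => clA.
have Ka : K a by left.
have Ku n : K (u n) by right; exists n.
pose a' : set_type K := SigSub (mem_set Ka).
have : ((set_val : set_type K -> T) @^-1` A) a'; last exact: nAa.
apply: clA => V [_ [[N oN <-] Na] NV].
have [n _ /(_ n (leqnn n)) Nn] := ua _ (open_nbhs_nbhs (conj oN Na)).
pose un : set_type K := SigSub (mem_set (Ku n)).
by exists un; split; [exact: Au|exact: NV].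
Qed.

(** * Spaces of functions with the topology of pointwise convergence *)

(** Being a subspace of [C_p(X, Y)], told in terms of the evaluation map: this
    is all that the proof uses of the topology, and it spares the passage
    through the subspace, the continuous maps and the product. *)
Definition pointwise_topology (T X Y : topologicalType) (ev : T -> X -> Y) :=
  [/\ forall h, continuous (ev h),
      forall x, continuous (ev^~ x) &
      forall (G : set_system T) (a : T), Filter G ->
        (forall x, ev^~ x @ G --> ev a x) -> G --> a].

Lemma ptws_eval_continuous (X : Type) (Y : topologicalType) (x : X) :
  continuous (fun f : {ptws X -> Y} => f x).
Proof.
move=> f A fA; have /cvg_sup /(_ x) : nbhs f --> f by [].
by apply; apply: (@initial_continuous (X -> Y) Y (fun f => f x)).
Qed.

Lemma ptws_cvg (X : Type) (Y : topologicalType) (G : set_system {ptws X -> Y})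
    (f : {ptws X -> Y}) : Filter G ->
  (forall x, (fun f : {ptws X -> Y} => f x) @ G --> f x) -> G --> f.
Proof.
move=> FG Gf; apply/cvg_sup => x A [B [[C oC <-] Cfx] CA].
by apply: filterS CA _; apply: Gf; exact: open_nbhs_nbhs.
Qed.

Lemma pointwise_topology_Cp (X Y : topologicalType) (H : set (Cp X Y)) :
  pointwise_topology
    (fun (h : set_type H) x => (set_val h : continuousType X Y) x).
Proof.
pose toCp : set_type H -> Cp X Y := set_val.
pose toptws (f : Cp X Y) : {ptws X -> Y} := (f : continuousType X Y).
split.
- by move=> h x; exact: (@cts_fun _ _ (set_val h : continuousType X Y)).
- move=> x h.
  have c1 : {for h, continuous toCp} by exact: initial_continuous.
  have c2 : {for toCp h, continuous toptws}.
    exact: (@initial_continuous (continuousType X Y) {ptws X -> Y}).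
  exact: (continuous_comp (continuous_comp c1 c2)
                          (@ptws_eval_continuous X Y x _)).
- move=> G a FG Ga.
  have Gp : toptws \o toCp @ G --> toptws (toCp a) by apply: ptws_cvg.
  move=> A [_ [[_ [B oB <-] <-] Ba] BA].
  by apply: filterS BA _; apply: Gp; exact: open_nbhs_nbhs.
Qed.

Section PointwiseSpace.
Variables (T X Y : topologicalType) (ev : T -> X -> Y).
Hypothesis evP : pointwise_topology ev.

Lemma ev_continuous h : continuous (ev h). Proof. by case: evP. Qed.

Lemma ev_at_continuous x : continuous (ev^~ x). Proof. by case: evP. Qed.

Lemma pointwise_cvg (G : set_system T) a : Filter G ->
  (forall x, ev^~ x @ G --> ev a x) -> G --> a.
Proof. by case: evP => _ _; exact. Qed.

Lemma nbhs_finite_eval a (F : set X) (N : X -> set Y) : finite_set F ->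
    (forall x, F x -> nbhs (ev a x) (N x)) ->
  nbhs a [set h | forall x, F x -> N x (ev h x)].
Proof.
move=> fF Na.
apply: (filter_forall_finite (Q := fun x => [set h | N x (ev h x)])) => //.
by move=> x Fx; exact: (ev_at_continuous (Na x Fx)).
Qed.

(** The functions of [A] that agree with [a] on finite sets form a filter that
    converges pointwise to [a]. *)
Lemma closure_agree (A : set T) a :
  (forall F, finite_set F ->
     exists2 h, A h & forall x, F x -> ev h x = ev a x) ->
  closure A a.
Proof.
move=> agr.
pose G : set_system T := filter_from (@finite_set X)
  (fun F => [set h | A h /\ forall x, F x -> ev h x = ev a x]).
have PG : ProperFilter G.
  apply: filter_from_proper; last by move=> F /agr[h Ah hF]; exists h.
  apply: filter_from_filter; first by exists set0.
  move=> F F' fF fF'; exists (F `|` F'); first by rewrite finite_setU.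
  by move=> h [Ah hFF']; split; split=> // x Fx; apply: hFF'; [left|right].
have Ga : G --> a.
  apply: pointwise_cvg => x N /nbhs_singleton Nx.
  by exists [set x]; [exact: finite_set1|move=> h [_ /(_ x erefl) /= ->]].
have GA : G A by exists set0 => // h [].
by move=> N /Ga GN; exact: (filter_ex (filterI GA GN)).
Qed.

Hypothesis hY : hausdorff_space Y.

Lemma closed_eval_eq x y : closed [set h | ev h x = y].
Proof.
apply: (@closed_comp _ _ (ev^~ x) [set y]); last exact: hausdorff_closed1.
by move=> h _; exact: ev_at_continuous.
Qed.

Lemma closed_exists_eval_eq (F : set X) y : finite_set F ->
  closed [set h | exists2 x, F x & ev h x = y].
Proof.
move=> fF; have := @closed_bigcup T X F (fun x => [set h | ev h x = y]) fF.
by apply => x _; exact: closed_eval_eq.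
Qed.

Lemma open_ev_neq h y : open [set x | ev h x <> y].
Proof.
rewrite -[X in open X]/(ev h @^-1` (~` [set y])).
apply: open_comp; first by move=> x _; exact: ev_continuous.
exact/closed_openC/hausdorff_closed1.
Qed.

Lemma closed_agreement h f : closed [set x | ev h x = ev f x].
Proof.
move=> x clx; apply: hY => A B hA fB.
have hAx : nbhs x (ev h @^-1` A) := @ev_continuous h x _ hA.
have fBx : nbhs x (ev f @^-1` B) := @ev_continuous f x _ fB.
have [z [/= zE [Az Bz]]] := clx _ (filterI hAx fBx).
by exists (ev h z); split => //; rewrite zE.
Qed.

End PointwiseSpace.

(** * Omega-covers and selections *)

Definition omega_covers (X : Type) (C : set (set X)) (Z : set X) :=
  forall F, finite_set F -> F `<=` Z -> exists2 U, C U & F `<=` U.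

Section CountablyCovered.
Variables (X : Type) (C : set (set X)).

Definition countably_covered (Z : set X) :=
  exists C', [/\ C' `<=` C, countable C' & omega_covers C' Z].

Lemma countably_covered_bigcup (I : Type) (D : set I) (W : I -> set X) Z :
  countable D -> (forall i, D i -> countably_covered (W i)) ->
  (forall F, finite_set F -> F `<=` Z -> exists2 i, D i & F `<=` W i) ->
  countably_covered Z.
Proof.
move=> cD DW ZW.
have /choice[C' C'P] : forall i, exists C', D i ->
    [/\ C' `<=` C, countable C' & omega_covers C' (W i)].
  move=> i; have [/DW[C' C'P]|nDi] := pselect (D i); first by exists C'.
  by exists set0.
exists (\bigcup_(i in D) C' i); split.
- by move=> U [i /C'P[C'C _ _] /C'C].
- by apply: bigcup_countable => // i /C'P[].
move=> F fF /(ZW F fF)[i Di FW]; have [_ _ /(_ F fF FW)[U CU FU]] := C'P i Di.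
by exists U => //; exists i.
Qed.

End CountablyCovered.

(** A variant of the property phi of Gerlits and Nagy. It selects as the
    property gamma does, except that a selected set need only look, from its
    finite subsets, like a part of a member of the family: this is what is left
    of such a part after a passage to the closure in a space of functions. *)
Definition selective (X : topologicalType) :=
  forall C : nat -> set (set X),
  (forall n, C n `<=` open) -> omega_covers (\bigcup_n C n) setT ->
  exists Z : nat -> set X,
    (forall i, exists n, omega_covers (C n) (Z i)) /\
    (forall x, \forall i \near \oo, Z i x).

(** For points (each [F_ p] a singleton) this is local finiteness; in general,
    local finiteness in the hyperspace of finite subsets of [X]. *)
Definition thin (I : Type) (X : topologicalType) (F_ : I -> set X) (P : set I) :=
  forall F, finite_set F ->
    exists U, [/\ open U, F `<=` U & finite_set [set p | P p /\ F_ p `<=` U]].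

(** Thinness says that the families [C n], of the open sets that contain at
    most [n] of the [F_ p], together omega-cover [X]. A set omega-covered by
    [C n] contains at most [n] of the [F_ p] as well, while each [F_ p] ends up
    inside the selected sets: there are countably many of them. *)
Lemma selective_thin_countable (X : topologicalType) (I : choiceType)
    (F_ : I -> set X) (P : set I) :
  selective X -> (forall p, finite_set (F_ p)) -> thin F_ P -> countable P.
Proof.
move=> selX finF thinP.
pose C n : set (set X) := [set U | open U /\
  forall s : {fset I}, [set` s] `<=` P -> (forall p, p \in s -> F_ p `<=` U) ->
  (#|` s| <= n)%N].
have [n U []//|F fF _|W [WC Wlim]] := selX C.
  have [U [oU FU finU]] := thinP F fF.
  exists U => //; exists #|` fset_set [set p | P p /\ F_ p `<=` U]| => //.
  split=> // s sP sU; apply: fsubset_leq_card; apply/fsubsetP => p ps.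
  by rewrite in_fset_set // inE; split; [exact: sP|exact: sU].
have cW i : countable [set p | P p /\ F_ p `<=` W i].
  apply: finite_set_countable; apply: contrapT => infW.
  have [n Wcov] := WC i; have [s sP sn] := infinite_set_fset n.+1 infW.
  have [||U [_ UC] sU] := Wcov (\bigcup_(p in [set` s]) F_ p).
  - by apply: bigcup_finite.
  - by move=> x [p /sP[_ pW] /pW].
  have : (#|` s| <= n)%N.
    by apply: UC => [p /sP[]//|p ps]; apply: subset_trans sU; exact: bigcup_sup.
  by rewrite leqNgt sn.
apply: (@sub_countable _ _ _ (\bigcup_i [set p | P p /\ F_ p `<=` W i])).
  apply: subset_card_le => p Pp.
  have : \forall i \near \oo, forall x, F_ p x -> W i x.
    by apply: filter_forall_finite => [|x _]; [exact: finF|exact: Wlim].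
  by move=> [i _ /(_ i (leqnn i)) pW]; exists i.
exact: bigcup_countable.
Qed.

(** Selection applied to the singletons of an enumeration of [C]: a set
    omega-covered by a single set is a subset of it. *)
Lemma selective_countable_gamma (X : topologicalType) (C : set (set X)) :
  selective X -> C `<=` open -> countable C -> omega_covers C setT ->
  exists U : nat -> set X, (forall n, C (U n)) /\
    forall x, \forall n \near \oo, U n x.
Proof.
move=> selX Cop cC Ccov.
have [U0 CU0 _] := Ccov set0 (finite_set0 _) (@sub0set _ _).
have /pfcard_geP[C0|[e]] := cC; first by rewrite C0 in CU0.
have eC n : C (e n) by exact: funS.
have [n U ->|F fF _|W [WC Wlim]] := selX (fun n => [set e n]).
- exact/Cop.
- have [U CU FU] := Ccov F fF (@subsetT _ _).
  have [n _ en] := @surj _ _ _ _ e U CU.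
  by exists U => //; exists n.
have /choice[s sP] : forall i, exists n, W i `<=` e n.
  move=> i; have [n nW] := WC i; exists n => x Wx.
  by have [||U -> /(_ x erefl)] := nW [set x]; [|move=> _ ->|].
exists (e \o s); split=> [n|x]; first exact: eC.
by apply: filterS (Wlim x) => i /sP.
Qed.

(** * Uncountable thin families *)

Section FreeFamily.
Variables (T X Y : topologicalType) (ev : T -> X -> Y).
Hypothesis evP : pointwise_topology ev.
Hypothesis hY : hausdorff_space Y.
Variables (K B : set T) (f : T) (y : Y) (Z : set X).
Hypothesis cK : compact K.
Hypothesis BK : B `<=` K.
Hypothesis clZ : closed Z.
Hypothesis fZ : forall x, Z x -> ev f x <> y.
Local Notation I := (T * {fset X})%type.
Implicit Types (p q : I) (P Q : set I).

Local Notation thinP := (@thin I X (fun p : I => [set` p.2])).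

(** The order of a free sequence. As [f] avoids [y] on [Z], the values on the
    finite set of a pair tell apart the functions placed before and after it. *)
Let before p q := (forall x, x \in p.2 -> ev q.1 x = ev f x) /\
                  (exists2 x, x \in q.2 & ev p.1 x = y).

(** End extension: a plain inclusion would not let thinness pass to unions. *)
Let ext P Q := P `<=` Q /\ forall p q, P p -> Q q -> ~ P q -> before p q.

Let good P := (forall p, P p -> B p.1 /\ [set` p.2] `<=` Z) /\ thinP P.

Let ext_refl P : ext P P. Proof. by split. Qed.

Let ext_trans P Q S : ext P Q -> ext Q S -> ext P S.
Proof.
move=> [PQ PQb] [QS QSb]; split; first exact: subset_trans QS.
move=> p q Pp Sq nPq; have [Qq|nQq] := pselect (Q q); first exact: PQb.
by apply: QSb => //; exact: PQ.
Qed.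

Let ext_bigcup (A : set (set I)) : total_on A ext ->
  forall P, A P -> ext P (\bigcup_(Q in A) Q).
Proof.
move=> Atot P AP; split; first exact: bigcup_sup.
move=> p q Pp [Q AQ Qq] nPq.
have [[_ PQ]|[QP _]] := Atot _ _ AP AQ; first exact: PQ.
by have := nPq (QP _ Qq).
Qed.

(** Let [F] witness that the union [S] of a chain without last element is not
    thin. The functions met beyond every member of the chain cluster at some
    [h] in [K], which agrees with [f] on all finite sets of [S]; these thus lie
    in the closed set [W] where [h] and [f] agree inside [Z]. Every function
    [q.1] of [S] takes the value [y] on [F `&` W]: if not, the open set [V]
    below contains [F] but no finite set placed after [q], and those before are
    finitely many inside some neighbourhood of [F]. Taking this value on the
    finite set [F `&` W] is a closed condition, so [h] satisfies it, although
    [h] equals [f] on [W] and [f] avoids [y] there. *)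
Let good_bigcup (A : set (set I)) : A `<=` good -> total_on A ext ->
  good (\bigcup_(Q in A) Q).
Proof.
move=> Agood Atot; set S := \bigcup_(Q in A) Q.
have SB p : S p -> B p.1 /\ [set` p.2] `<=` Z.
  by move=> [Q AQ Qp]; have [+ _] := Agood _ AQ; apply.
have [P0|/set0P[p0 Sp0]] := eqVneq S set0.
  split=> // F fF; exists setT; split=> //; first exact: openT.
  by rewrite P0 (_ : [set _ | _] = set0) // -subset0 => p [].
split=> // F fF; apply: contrapT => Fbad.
have [[Q AQ SQ]|nolast] := pselect (exists2 Q, A Q & S `<=` Q).
  have [_ /(_ F fF)[U [oU FU finU]]] := Agood _ AQ.
  by apply: Fbad; exists U; split => //; apply: sub_finite_set finU => p [/SQ].
pose G : set_system T :=
  filter_from A (fun Q => [set p.1 | p in S `\` Q]).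
have PG : ProperFilter G.
  apply: filter_from_proper; last first.
    move=> Q AQ; apply: contrapT => noQ; apply: nolast; exists Q => // p Sp.
    by apply: contrapT => nQp; apply: noQ; exists p.1; exists p.
  apply: filter_from_filter; first by have [Q AQ _] := Sp0; exists Q.
  move=> P Q AP AQ.
  have [[PQ _]|[QP _]] := Atot _ _ AP AQ; [exists Q => //|exists P => //].
    by move=> _ [p [Sp nQp] <-]; split; exists p => //; split => // /PQ.
  by move=> _ [p [Sp nPp] <-]; split; exists p => //; split => // /QP.
have GK : G K.
  have [Q AQ _] := Sp0; exists Q => // _ [p [Sp _] <-].
  by apply: BK; case: (SB _ Sp).
have [h [Kh Gh]] := cK PG GK.
have hS p : S p -> [set` p.2] `<=` [set x | ev h x = ev f x] `&` Z.
  move=> Sp x px; split; last by case: (SB _ Sp) => _; apply.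
  apply: (cluster_closed (closed_eval_eq evP hY (x := x) (y := ev f x)) _ Gh).
  have [Q AQ Qp] := Sp; exists Q => // _ [q [Sq nQq] <-] /=.
  by have [_ /(_ p q Qp Sq nQq) [+ _]] := ext_bigcup Atot AQ; apply.
set W := _ `&` Z in hS.
have clW : closed W by apply: closedI => //; exact: (closed_agreement evP hY).
have hit q : S q -> exists2 x, (F `&` W) x & ev q.1 x = y.
  move=> Sq; apply: contrapT => nohit; have [Q AQ Qq] := Sq.
  have [_ /(_ F fF)[U [oU FU finU]]] := Agood _ AQ.
  pose V := U `&` ([set x | ev q.1 x <> y] `|` ~` W).
  apply: Fbad; exists V; split.
  - apply: openI => //; apply: openU; first exact: (open_ev_neq evP hY).
    exact: closed_openC.
  - move=> x Fx; split; first exact: FU.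
    have [Wx|] := pselect (W x); last by right.
    by left=> qx; apply: nohit; exists x.
  - apply: sub_finite_set finU => p [Sp pV]; split; last by move=> x /pV[].
    apply: contrapT => nQp.
    have [_ /(_ q p Qq Sp nQp) [_ [x px qx]]] := ext_bigcup Atot AQ.
    by have [_ [|]] := pV _ px; [|apply; exact: (hS _ Sp)].
have : [set h | exists2 x, (F `&` W) x & ev h x = y] h.
  apply: (cluster_closed _ _ Gh).
    by apply: (closed_exists_eval_eq evP hY); exact: finite_setIl.
  by have [Q AQ _] := Sp0; exists Q => // _ [q [Sq _] <-]; exact: hit.
by move=> [x [_ [/= -> Zx]]]; exact: fZ.
Qed.

(** In the intended use, [f] adheres to [B] but to no countable subset of [B];
    the former gives [approx] and the latter [separated]. *)
Hypothesis approx : forall M, countable M ->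
  exists2 h, B h & forall x, M x -> ev h x = ev f x.
Hypothesis separated : forall D, D `<=` B -> countable D ->
  exists F, [/\ finite_set F, F `<=` Z &
               forall h, D h -> exists2 x, F x & ev h x = y].

(** A thin family that is maximal for end extension cannot be countable:
    [approx] gives a function agreeing with [f] on all its finite sets, and
    [separated] a finite set on which all its functions somewhere take the
    value [y]; together they form a pair that can be added at the end. *)
Lemma exists_uncountable_thin : exists P, ~ countable P /\ thinP P.
Proof.
pose R (P Q : {P | good P}) := `[< ext (sval P) (sval Q) >].
have [|||A Atot|[P Pgood] Pmax] := @Zorn {P | good P} R.
- by move=> P; apply/asboolP.
- move=> P Q S /asboolP PQ /asboolP QS; apply/asboolP; exact: ext_trans QS.
- move=> [P gP] [Q gQ] /asboolP[/= PQ _] /asboolP[/= QP _].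
  exact/eq_exist/seteqP.
- pose A' : set (set I) := [set sval P | P in A].
  have A'good : A' `<=` good by move=> _ [P _ <-]; exact: (svalP P).
  have A'tot : total_on A' ext.
    move=> _ _ [P AP <-] [Q AQ <-].
    by have [/asboolP|/asboolP] := Atot _ _ AP AQ; [left|right].
  exists (exist _ _ (good_bigcup A'good A'tot)) => P AP.
  by apply/asboolP => /=; apply: ext_bigcup => //; exists P.
exists P; split; last exact: Pgood.2.
move=> cP; have [PB Pthin] := Pgood.
have [|h Bh hf] := @approx (\bigcup_(p in P) [set` p.2]).
  by apply: bigcup_countable => // p _; exact: countable_fset.
have [||F [fF FZ FD]] := @separated [set p.1 | p in P].
- by move=> _ [p /PB[Bp _] <-].
- exact: sub_countable (card_image_le _ _) cP.
have [s sE] : exists s : {fset X}, F = [set` s] by exact/finite_fsetP.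
pose r : I := (h, s).
have nPr : ~ P r.
  move=> Pr; have [x Fx hx] := FD h (imageP _ Pr).
  apply: (fZ (FZ _ Fx)); rewrite -hf //; exists r => //.
  by move: Fx; rewrite sE.
have good' : good (P `|` [set r]).
  split=> [p [/PB//|->]|F' fF'] /=; first by rewrite -sE.
  have [U [oU FU finU]] := Pthin F' fF'; exists U; split=> //.
  apply: (@sub_finite_set _ _ ([set p | P p /\ [set` p.2] `<=` U] `|` [set r])).
    by move=> p [[Pp|->] pU]; [left|right].
  by rewrite finite_setU.
have ext' : ext P (P `|` [set r]).
  split; first by move=> p; left.
  move=> p q Pp [//|->] _; split.
    by move=> x px; apply: hf; exists p.
  have [x Fx px] := FD p.1 (imageP _ Pp).
  by exists x => //; move: Fx; rewrite sE.
have /= := Pmax (exist _ _ good') (asboolT ext') => -[E].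
by apply: nPr; rewrite -E; right.
Qed.

End FreeFamily.

(** * From k-spaces to the property gamma *)

Section KSpace.
Variables (T X Y : topologicalType) (ev : T -> X -> Y) (g : nat -> Y) (h0 : T).
Hypothesis evP : pointwise_topology ev.
Hypothesis hY : hausdorff_space Y.
Hypothesis gP : closed_discrete_sequence g.
Hypothesis h0E : forall x, ev h0 x = g 0%N.
Hypothesis extendable : forall (A F : set X) n,
  closed A -> finite_set F -> F `<=` ~` A ->
  exists h, (forall x, F x -> ev h x = g 0%N) /\ (forall x, A x -> ev h x = g n).
Hypothesis kT : k_space T.

Let closed_omega_covered (C : set (set X)) y :
  closed [set h | omega_covers C [set x | ev h x <> y]].
Proof.
move=> h clh F fF Fh.
have FN : nbhs h [set h' | forall x, F x -> ev h' x <> y].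
  apply: (nbhs_finite_eval evP (N := fun=> [set z | z <> y])) => // x Fx.
  apply: open_nbhs_nbhs; split; last exact: Fh.
  exact/closed_openC/hausdorff_closed1.
have [h' [h'C Fh']] := clh _ FN.
exact: h'C.
Qed.

(** Unless some [C m] already omega-covers [X], each [B n] below omits the
    constant [h0], although it adheres to their union. Each [B n] is closed, so
    some compact set [K] has members in infinitely many [B n]: otherwise its
    trace on the union would be closed. At a point [x] the values of [K] form a
    compact set, which avoids [g n.+1] for all large [n]; hence [x] lies in the
    sets given by these members from some rank on. *)
Lemma k_space_selective : selective X.
Proof.
move=> C Cop Ccov.
have [[m Cm]|nocov] := pselect (exists m, omega_covers (C m) setT).
  by exists (fun=> setT); split; [exists m|move=> x; exact: nearW].
pose B n := [set h | omega_covers (C n) [set x | ev h x <> g n.+1]].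
have g0S n : g 0%N <> g n.+1 by case: gP => ginj _ _ /ginj.
have h0B n : ~ B n h0.
  move=> Bh0; apply: nocov; exists n => F fF _; apply: Bh0 => // x _ /=.
  by rewrite h0E.
have ncl : ~ closed (\bigcup_n B n).
  move=> clB; have [] : (\bigcup_n B n) h0; last by move=> n _; exact: h0B.
  apply: clB; apply: (closure_agree evP) => F fF.
  have [//|U [n _ CU] FU] := Ccov F fF.
  have [||h [hF hU]] := @extendable (~` U) F n.+1 _ fF.
  - exact/open_closedC/(Cop n).
  - by rewrite setCK.
  exists h; last by move=> x /hF ->; rewrite h0E.
  exists n => // F' fF' F'h; exists U => // x /F'h /= hx.
  by apply: contrapT => /hU.
have [K [f [cK Kf nSf clf]]] := k_space_compact_witness kT ncl.
have inf N : exists2 n, (N <= n)%N & B n `&` K !=set0.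
  apply: contrapT => noN.
  have clB : closed (\bigcup_(n in `I_N) B n).
    by apply: closed_bigcup => // n _; exact: closed_omega_covered.
  have [n _ Bn] : (\bigcup_(n in `I_N) B n) f.
    apply: clB => V /clf[h [[[n _ Bn] Kh] Vh]]; exists h; split => //.
    exists n => //=; rewrite ltnNge; apply/negP => Nn.
    by apply: noN; exists n => //; exists h.
  by apply: nSf; exists n.
have {inf} /choice[s sP] :
    forall N, exists nh : nat * T, [/\ (N <= nh.1)%N, B nh.1 nh.2 & K nh.2].
  by move=> N; have [n Nn [h [Bh Kh]]] := inf N; exists (n, h).
exists (fun i => [set x | ev (s i).2 x <> g (s i).1.+1]); split.
  by move=> i; exists (s i).1; case: (sP i).
move=> x.
have cKx : compact (ev^~ x @` K).
  apply: continuous_compact => //; apply: continuous_subspaceT.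
  exact: (ev_at_continuous evP).
have [N NP] := compact_closed_discrete_sequence gP cKx.
exists N => // i /= Ni six; have [Nsi _ Ki] := sP i.
apply: (NP (s i).1.+1); first by rewrite leqW // (leq_trans Ni).
by exists (s i).2.
Qed.

End KSpace.

Lemma finite_fiber_le (X : Type) (M : set X) (c : X -> nat) n :
  {in M &, injective c} -> finite_set [set x | M x /\ (c x <= n)%N].
Proof.
move=> cinj; apply: (@sub_finite_set _ _
    (\bigcup_(k in `I_n.+1) [set x | M x /\ c x = k])).
  by move=> x [Mx xn]; exists (c x).
apply: bigcup_finite => // k _.
have [[x [Mx <-]]|no] := pselect (exists x, M x /\ c x = k).
  apply: (@sub_finite_set _ _ [set x]); last exact: finite_set1.
  by move=> z [Mz zx]; apply: cinj; rewrite ?inE.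
apply: (@sub_finite_set _ _ set0); last exact: finite_set0.
by move=> z zk; apply: no; exists z.
Qed.

Section KGamma.
Variables (R : realType) (T X Y : topologicalType) (d : Y -> Y -> R).
Variables (ev : T -> X -> Y) (g : nat -> Y) (h0 : T).
Hypothesis dY : metrizes d.
Hypothesis evP : pointwise_topology ev.
Hypothesis gP : closed_discrete_sequence g.
Hypothesis h0E : forall x, ev h0 x = g 0%N.
Hypothesis extendable : forall (A F : set X) n,
  closed A -> finite_set F -> F `<=` ~` A ->
  exists h, (forall x, F x -> ev h x = g 0%N) /\ (forall x, A x -> ev h x = g n).
Hypothesis kT : k_space T.

Let hY : hausdorff_space Y := metrizes_hausdorff dY.

Section Subcover.
Variable C : set (set X).
Hypothesis Cop : C `<=` open.
Hypothesis Ccov : omega_covers C setT.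

Let y := g 1%N.
Let S : set T := [set h | countably_covered C [set x | ev h x <> y]].

(** The constant [h0] adheres to [S], but no countable part of [C] omega-covers
    the set where it differs from [y], which is the whole space. *)
Let S_not_closed : ~ countably_covered C setT -> ~ closed S.
Proof.
move=> nC clS; apply: nC.
have g01 : g 0%N <> y by case: gP => ginj _ _ /ginj.
have : S h0.
  apply: clS; apply: (closure_agree evP) => F fF.
  have [U CU FU] := Ccov fF (@subsetT _ _).
  have [||h [hF hU]] := @extendable (~` U) F 1%N _ fF.
  - exact/open_closedC/Cop.
  - by rewrite setCK.
  exists h; last by move=> x /hF ->; rewrite h0E.
  exists [set U]; split; first by move=> _ ->.
    exact: countable1.
  move=> F' fF' F'h; exists U => // x /F'h /= hx.
  by apply: contrapT => /hU.
by rewrite /S /= (_ : [set x | _] = setT) // -subTset => x _ /=; rewrite h0E.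
Qed.

(** A cluster point of functions that approximate [f] better and better on
    larger and larger finite parts of [M] agrees with [f] on [M], and it
    remains in [S] because [S] contains the closure of each of its countable
    subsets. *)
Lemma closure_countable_agreement K f M : compact K -> closure (S `&` K) f ->
  countable M -> exists2 h, (S `&` K) h & forall x, M x -> ev h x = ev f x.
Proof.
move=> cK clf /countable_injP[c cinj].
have /choice[u uP] : forall n, exists h, (S `&` K) h /\
    forall x, M x -> (c x <= n)%N -> (d (ev f x) (ev h x) < n.+1%:R^-1)%R.
  move=> n; have fM := @finite_fiber_le X M c n cinj.
  have [|h [SKh hM]] := clf _ (nbhs_finite_eval evP (a := f)
      (N := fun x => [set z | (d (ev f x) z < n.+1%:R^-1)%R]) fM _).
    by move=> x _; apply: (nbhs_ball_dist dY); rewrite invr_gt0.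
  by exists h; split => // x Mx xn; exact: hM.
have [|h [Kh uh]] := cK (u @ \oo) _.
  by exists 0%N => // n _; case: (uP n) => -[].
exists h; first (split => //).
  apply: (@countably_covered_bigcup _ C nat setT
    (fun n => [set x | ev (u n) x <> y])) => //.
    by move=> n _; case: (uP n) => -[].
  move=> F fF Fh.
  have Nh : nbhs h [set h' | forall x, F x -> ev h' x <> y].
    apply: (nbhs_finite_eval evP (N := fun=> [set z | z <> y])) => // x Fx.
    apply: open_nbhs_nbhs; split; last exact: Fh.
    exact/closed_openC/hausdorff_closed1.
  have : (u @ \oo) (range u) by exists 0%N => // n _; exists n.
  by move=> /uh /(_ Nh) [_ [[n _ <-] /= un]]; exists n.
move=> x Mx; apply: contrapT => hfx.
have e0 := dist_gt0 dY hfx; set e := d _ _ in e0.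
have e20 : (0 < e / 2)%R by rewrite divr_gt0.
have Nh : nbhs h [set h' | (d (ev h x) (ev h' x) < e / 2)%R].
  exact: (ev_at_continuous evP (nbhs_ball_dist dY (ev h x) e20)).
have ufx : \forall n \near \oo, (d (ev f x) (ev (u n) x) < e / 2)%R.
  near=> n; have cxn : (c x <= n)%N by near: n; exact: nbhs_infty_ge.
  apply: lt_trans ((uP n).2 x Mx cxn) _.
  by near: n; exact: (near_infty_natSinv_lt (PosNum e20)).
have : (u @ \oo) [set h' | (d (ev f x) (ev h' x) < e / 2)%R] := ufx.
move=> /uh /(_ Nh) [h' /= [fh' hh']].
have := dist_triangle dY (ev h x) (ev h' x) (ev f x).
by rewrite (dist_sym dY (ev h' x)) -/e; lra.
Unshelve. all: by end_near. Qed.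

Hypothesis selX : selective X.

(** Otherwise some [f] outside [S] adheres to the trace of [S] on a compact set
    [K]. As [f] is not in [S], the points where it differs from [y] are not
    countably covered. Finite sets of points that witness this against
    countably many functions of [S] feed [exists_uncountable_thin], whose
    conclusion contradicts selectivity. *)
Lemma k_space_countable_subcover : countably_covered C setT.
Proof.
apply: contrapT => /S_not_closed nclS.
have [K [f [cK Kf nSf clf]]] := k_space_compact_witness kT nclS.
(* The set where [f] differs from [y] is only open; the family of finite sets
   must lie in a closed one, so it is replaced by one of its closed pieces. *)
pose Z n := [set x | (n.+1%:R^-1 <= d y (ev f x))%R].
have [n nZ] : exists n, ~ countably_covered C (Z n).
  apply: contrapT => noZ; apply: nSf.
  apply: (@countably_covered_bigcup _ C nat setT Z) => //.
    by move=> n _; apply: contrapT => nZ; apply: noZ; exists n.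
  move=> F fF Ff.
  have [n _ /(_ n (leqnn n)) FZ] : \forall n \near \oo, forall x, F x -> Z n x.
    apply: filter_forall_finite => // x /Ff /nesym /(dist_gt0 dY) yf.
    by apply: filterS (near_infty_natSinv_lt (PosNum yf)) => k /ltW.
  by exists n.
have clZ : closed (Z n).
  rewrite (_ : Z n = ev f @^-1` (~` [set z | (d y z < n.+1%:R^-1)%R])).
    apply: closed_comp; first by move=> x _; exact: (ev_continuous evP).
    exact/open_closedC/(open_dist_ball dY).
  by apply/seteqP; split=> x /=; rewrite /Z /= leNgt => /negP.
have fZ x : Z n x -> ev f x <> y.
  move=> + fx; rewrite /Z /= fx (dist_eq0 dY y y).2 //.
  by rewrite leNgt invr_gt0 ltr0n.
have BK : S `&` K `<=` K by move=> h [].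
have sep D : D `<=` S `&` K -> countable D -> exists F,
    [/\ finite_set F, F `<=` Z n & forall h, D h -> exists2 x, F x & ev h x = y].
  move=> DSK cD; apply: contrapT => noF; apply: nZ.
  apply: (@countably_covered_bigcup _ C T D (fun h => [set x | ev h x <> y])).
  - exact: cD.
  - by move=> h /DSK[].
  move=> F fF FZ; apply: contrapT => noh; apply: noF; exists F; split=> // h Dh.
  apply: contrapT => nohit; apply: noh; exists h => // x Fx hx.
  by apply: nohit; exists x.
have [P [ncP]] := exists_uncountable_thin evP hY cK BK clZ fZ
  (fun M => closure_countable_agreement cK clf) sep.
by move=> /(selective_thin_countable selX) cP; apply: ncP; exact: cP.
Qed.

End Subcover.

Lemma k_space_gamma : property_gamma X.
Proof.
move=> C Cop Ccov.
have selX := k_space_selective evP hY gP h0E extendable kT.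
have Ccov' : omega_covers C setT by move=> F fF _; exact: Ccov.
have [C' [C'C cC' C'cov]] := k_space_countable_subcover Cop Ccov' selX.
have [U [C'U Ulim]] :=
  selective_countable_gamma selX (subset_trans C'C Cop) cC' C'cov.
exists U; split; first by move=> n; exact/C'C.
by rewrite -subTset => x _; have [n _ nU] := Ulim x; exists n.
Qed.

End KGamma.

(** * From the property gamma to the Fréchet-Urysohn property *)

Lemma infinite_injection (X : choiceType) :
  infinite_set [set: X] -> exists s : nat -> X, injective s.
Proof.
elim/choicePpointed: X => X; first by rewrite emptyE.
move=> /infiniteP/ppcard_leP[f]; exists f => i j.
by apply: inj; rewrite inE.
Qed.

Section GammaFrechet.
Variables (R : realType) (T X Y : topologicalType) (d : Y -> Y -> R).
Variable ev : T -> X -> Y.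
Hypothesis dY : metrizes d.
Hypothesis evP : pointwise_topology ev.
Hypothesis T1 : forall x : X, closed [set x].
Local Open Scope ring_scope.

Let near_set a n h := [set x | d (ev a x) (ev h x) < n.+1%:R^-1].

Let open_near_set a n h : open (near_set a n h).
Proof.
rewrite openE => x; rewrite /near_set /= => dx.
set r := n.+1%:R^-1 in dx *; pose e := (r - d (ev a x) (ev h x)) / 2.
have e0 : 0 < e by rewrite divr_gt0 // subr_gt0.
have nbhs_h k : nbhs x [set z | d (ev k x) (ev k z) < e].
  exact: (ev_continuous evP (nbhs_ball_dist dY (ev k x) e0)).
apply: filterS (filterI (nbhs_h a) (nbhs_h h)) => z /= [az hz].
have := dist_triangle dY (ev a z) (ev a x) (ev h z).
have := dist_triangle dY (ev a x) (ev h x) (ev h z).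
by move: az hz; rewrite (dist_sym dY (ev a z) (ev a x)) /e -/r; lra.
Qed.

Let near_set_le a m n h : (m <= n)%N -> near_set a n h `<=` near_set a m h.
Proof.
move=> mn x /lt_le_trans; apply.
by rewrite lef_pV2 ?posrE // ler_nat.
Qed.

Let cvg_near_set a (u : nat -> T) :
  (forall x n, \forall i \near \oo, near_set a n (u i) x) -> u @ \oo --> a.
Proof.
move=> ua; apply: (pointwise_cvg evP) => x N /(nbhs_dist dY)[e e0 eN].
have [n _ /(_ n (leqnn n)) /= ne] := near_infty_natSinv_lt (PosNum e0).
by apply: filterS (ua x n) => i aui; apply: eN; exact: lt_trans ne.
Qed.

(** For [X] infinite, remove the [n]-th point of an injective sequence from
    each set where a function of [A] is [n.+1%:R^-1]-close to [a]. These sets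
    still omega-cover [X], and a sequence of them converging to [X] uses each
    [n] finitely many times only, since each removed point must be recovered;
    so the precision of the approximation tends to infinity along the sequence.
    For [X] finite there are not enough points, but then each precision is
    reached by a single function on all of [X]. *)
Lemma gamma_frechet_urysohn : property_gamma X -> frechet_urysohn T.
Proof.
move=> gX A a cla.
have appr n F : finite_set F -> exists2 h, A h & F `<=` near_set a n h.
  move=> fF; have [|h [Ah hF]] := cla _ (nbhs_finite_eval evP (a := a)
      (N := fun x => [set z | d (ev a x) z < n.+1%:R^-1]) fF _).
    by move=> x _; apply: (nbhs_ball_dist dY); rewrite invr_gt0.
  by exists h.
have [finX|/infinite_injection[s sinj]] := pselect (finite_set [set: X]).
  have /choice[u uP] : forall n, exists h, A h /\ setT `<=` near_set a n h.
    by move=> n; have [h] := appr n _ finX; exists h.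
  exists u; split=> [n|]; first exact: (uP n).1.
  apply: cvg_near_set => x n; exists n => // i /= ni.
  exact: (near_set_le ni ((uP i).2 x I)).
pose C := [set U | exists nh : nat * T,
  A nh.2 /\ U = near_set a nh.1 nh.2 `\ s nh.1].
have Cop : C `<=` open.
  by move=> _ [[n h] [_ ->]]; apply: openI => //; exact: closed_openC.
have Ccov : omega_cover C.
  move=> F fF; have [n nF] : exists n, ~ F (s n).
    apply: contrapT => sF; apply: infinite_nat.
    rewrite (_ : setT = s @^-1` F).
      by apply: finite_preimage => // i j _ _; exact: sinj.
    apply/seteqP; split=> // n _ /=; apply: contrapT => nF; apply: sF.
    by exists n.
  have [h Ah hF] := appr n F fF.
  exists (near_set a n h `\ s n); first by exists (n, h).
  by move=> x Fx; split; [exact: hF|move=> /= xs; apply: nF; rewrite -xs].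
have [U [/choice[nh nhP] Ulim]] := gX C Cop Ccov.
have {}Ulim x : \forall i \near \oo, U i x.
  have [n _ nU] : (\bigcup_n \bigcap_(i in [set i | (n <= i)%N]) U i) x.
    by rewrite Ulim.
  by exists n.
exists (fun i => (nh i).2); split=> [i|]; first exact: (nhP i).1.
apply: cvg_near_set => x m.
have mnh : \forall i \near \oo, forall k, `I_m k -> (nh i).1 <> k.
  apply: filter_forall_finite => [|k _]; first exact: finite_II.
  apply: filterS (Ulim (s k)) => i; rewrite (nhP i).2 => -[_ + ki].
  by rewrite ki; apply.
apply: filterS2 mnh (Ulim x) => i mi; rewrite (nhP i).2 => -[+ _].
by apply: near_set_le; rewrite leqNgt; apply/negP => /mi.
Qed.

End GammaFrechet.

(** With an empty closed set, the hypothesis separates two points by a map. *)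
Lemma tychonoff_wrt_closed1 (X Y : topologicalType) (y y' : Y) (x : X) :
  hausdorff_space Y -> y <> y' -> tychonoff_wrt X Y -> closed [set x].
Proof.
move=> hY yy' XY; rewrite -[X in closed X]setCK; apply: open_closedC.
rewrite openE => z /= zx.
have [|||f [fc fE _]] :=
  XY set0 y [set x; z] (fun t => if t == x then y else y').
- exact: closed0.
- by rewrite finite_setU; split; exact: finite_set1.
- by rewrite setC0.
have fz : f z <> y.
  by rewrite fE; [case: eqP => // _; exact: nesym|right].
have fx : f x = y by rewrite fE ?eqxx //; left.
have oy : open (f @^-1` (~` [set y])).
  apply: open_comp => [t _|]; first exact: fc.
  exact/closed_openC/hausdorff_closed1.
apply: filterS (open_nbhs_nbhs (conj oy fz)) => t /= ft tx.
by apply: ft; rewrite tx.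
Qed.

(** * The equivalence *)

Theorem theorem4p3 (R : realType) (X Y : topologicalType)
    (g : nat -> Y) (H : set (Cp X Y)) :
  metrizable R Y -> ~ compact [set: Y] ->
  tychonoff_wrt X Y ->
  closed_discrete_sequence g ->
  relatively_tychonoff (range g) H ->
  H (cst (g 0%N) : continuousType X Y) ->
  [<-> frechet_urysohn (set_type H);
       sequential (set_type H);
       k_space (set_type H);
       property_gamma X].
Proof.
move=> [d dY] _ XY gP Htych H0.
have evP := pointwise_topology_Cp H.
have hY := metrizes_hausdorff dY.
tfae.
- exact: frechet_urysohn_sequential.
- exact: sequential_k_space.
- pose h0 : set_type H := SigSub (mem_set H0).
  apply: (k_space_gamma dY evP gP (h0 := h0)) => // A F n clA fF FA.
  have [||f [Hf fF0 fA]] :=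
    Htych A F (g n) (cst (g 0%N) : continuousType X Y) clA fF FA.
  - by exists n.
  - by move=> _ [x _ <-]; exists 0%N.
  exists (SigSub (mem_set Hf)); split => x; first exact: fF0.
  by move=> Ax; apply: fA; exists x.
- apply: (gamma_frechet_urysohn dY evP) => x.
  have g01 : g 0%N <> g 1%N by case: gP => ginj _ _ /ginj.
  exact: (tychonoff_wrt_closed1 hY g01 XY).
Qed.
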